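(* Let $G$ be a finite group, $k$ a field of characteristic $0$ and $\beta\in Z^3(G,k^* )$. Then, as algebras, $$K_{global}^{\beta}(I(pt,G),G)=D^\beta(k[G])^{\rm comm}$$ and $$\mathrm{Ind}^{DPR}\big(K^{\beta}_{global}(I(pt,G),G)\big)=D^\beta(k[G]).$$
   Context: $\beta$ is a normalized 3-cocycle ($\beta(h,l,m)\beta(g,hl,m)\beta(g,h,l)=\beta(gh,l,m)\beta(g,h,lm)$, $\beta=1$ if an argument is $e$), $\theta_g(x,y)=\dfrac{\beta(g,x,y)\,\beta(x,y,(xy)^{-1}g(xy))}{\beta(x,x^{-1}gx,y)}$. As an algebra $D^\beta(k[G])$ has basis $g\llcorner x$ ($g,x\in G$) and product $(g\llcorner x)(h\llcorner y)=\delta_{g,xhx^{-1}}\theta_g(x,y)\,g\llcorner xy$. $D^\beta(k[G])^{\rm comm}$ is the subalgebra spanned by the $g\llcorner x$ with $gx=xg$. $Z(g)$ is the centralizer of $g$; $\theta_g$ restricted to $Z(g)$ is a 2-cocycle; $k^{\theta_g}[Z(g)]$ is the twisted group ring $1_x1_y=\theta_g(x,y)1_{xy}$. For a $G$-variety $X$, $K^\beta_{global}(I(X,G),G):=\bigoplus_{g\in G}K^{\theta_g}_{global}(X^g,Z(g))$, where for a finite group $H$ acting on $Y$ and $\alpha\in Z^2(H,k^* )$, $K^\alpha_{global}(Y,H)=\bigoplus_{m\in H}K(Y^m)$ with product $v_{m_1}*_\alpha v_{m_2}=\alpha(m_1,m_2)\,v_{m_1}*v_{m_2}$, $*$ being the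 stringy product on $K_{global}(Y,H)$ ($K$-theory with coefficients in $k$). For $Y=pt$ the stringy product is $K_{global}(pt,H)=k[H]$, the group ring, because all obstruction and normal bundles vanish. In the case $X=pt$ the action of $G$ on $pt$ is trivial. DPR induction of algebras: if $A=\bigoplus_{g\in G}B_g$ with $B_g=k^{\theta_g}[Z(g)]\otimes B_e$ free $Z(g)$-Frobenius algebras, $B_e$ a Frobenius algebra with $G$-action, then $\mathrm{Ind}^{DPR}(A):=\bigoplus_{g\in G}k[G]\otimes_{k^{\theta_g}[Z(g)]}B_g\cong D^\beta(k[G])\otimes B_e$, where $k^{\theta_g}[Z(g)]$ acts on the right of $k[G]$ by $x\cdot z=\theta_{xgx^{-1}}(x,z)\,xz$, $D^\beta(k[G])$ acts by $(h\llcorner x)(r\otimes v)=\delta_{h,xrg(xr)^{-1}}\theta_h(x,r)\,xr\otimes v$, the element $r\otimes(1\otimes b)$ of the $g$-summand corresponds to $(rgr^{-1}\llcorner r)\otimes b$, and the algebra structure is the diagonal (factorwise) one on $D^\beta(k[G])\otimes B_e$. *)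

(* Defs.v *)
From HB Require Import structures.
From mathcomp Require Import all_boot all_order all_fingroup all_algebra.
From mathcomp Require Import falgebra.
From mathcomp Require Import ring.

Set Implicit Arguments.
Unset Strict Implicit.
Unset Printing Implicit Defensive.

Import GRing.Theory.
Local Open Scope ring_scope.

(* For a finite set I and a k-module V, the tensor product k[I] (x) V is
   represented by {ffun I -> V}; [single i v] is the pure tensor i (x) v. *)
Definition single (I : finType) (V : nmodType) (i : I) (v : V) : {ffun I -> V} :=
  [ffun j => if j == i then v else 0].

Section BilinearExtension.
Variables (k : fieldType) (I : finType).
Variable e : I -> I -> {ffun I -> k^o}.
Implicit Types u v w : {ffun I -> k^o}.

Definition bilin u v : {ffun I -> k^o} :=
  \sum_i \sum_j ((u i : k) * (v j : k)) *: e i j.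

Lemma bilinDl : left_distributive bilin +%R.
Proof.
move=> u v w; rewrite /bilin -big_split; apply: eq_bigr => i _.
rewrite -big_split; apply: eq_bigr => j _.
by rewrite ffunE mulrDl scalerDl.
Qed.

Lemma bilinDr : right_distributive bilin +%R.
Proof.
move=> u v w; rewrite /bilin -big_split; apply: eq_bigr => i _.
rewrite -big_split; apply: eq_bigr => j _.
by rewrite ffunE mulrDr scalerDl.
Qed.

Lemma bilinZl a u v : a *: bilin u v = bilin (a *: u) v.
Proof.
rewrite /bilin scaler_sumr; apply: eq_bigr => i _.
rewrite scaler_sumr; apply: eq_bigr => j _.
by rewrite scalerA ffunE mulrA.
Qed.

Lemma bilinZr a u v : a *: bilin u v = bilin u (a *: v).
Proof.
rewrite /bilin scaler_sumr; apply: eq_bigr => i _.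
rewrite scaler_sumr; apply: eq_bigr => j _.
by rewrite scalerA ffunE; congr (_ *: _); rewrite /GRing.scale /= mulrCA.
Qed.


Lemma bilin_suml (J : Type) (r : seq J) P (F : J -> {ffun I -> k^o}) v :
  bilin (\sum_(i <- r | P i) F i) v = \sum_(i <- r | P i) bilin (F i) v.
Proof.
elim/big_rec2: _ => [|i x y _ <-]; last by rewrite bilinDl.
by have := bilinDl 0 0 v; rewrite addr0 => /eqP; rewrite -subr_eq0 opprD addNKr oppr_eq0 => /eqP.
Qed.

Lemma bilin_sumr (J : Type) (r : seq J) P (F : J -> {ffun I -> k^o}) v :
  bilin v (\sum_(i <- r | P i) F i) = \sum_(i <- r | P i) bilin v (F i).
Proof.
elim/big_rec2: _ => [|i x y _ <-]; last by rewrite bilinDr.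
by have := bilinDr v 0 0; rewrite addr0 => /eqP; rewrite -subr_eq0 opprD addNKr oppr_eq0 => /eqP.
Qed.

Lemma single_decomp u : u = \sum_i (u i : k) *: single i (1 : k^o).
Proof.
apply/ffunP => j; rewrite sum_ffunE (bigD1 j) //= big1 => [|i ij].
  by rewrite addr0 !ffunE eqxx; rewrite /GRing.scale /= mulr1.
by rewrite !ffunE eq_sym (negbTE ij) scaler0.
Qed.

Lemma bilin_single i j : bilin (single i (1 : k^o)) (single j (1 : k^o)) = e i j.
Proof.
rewrite /bilin (bigD1 i) //= (bigD1 j) //= !ffunE !eqxx mulr1 scale1r.
rewrite !big1 ?addr0 // => l li.
  by rewrite big1 // => m _; rewrite ffunE (negbTE li) mul0r scale0r.
by rewrite !ffunE (negbTE li) mulr0 scale0r.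
Qed.

Lemma bilin_singler u j :
  bilin u (single j (1 : k^o)) = \sum_i (u i : k) *: e i j.
Proof.
rewrite {1}(single_decomp u) bilin_suml; apply: eq_bigr => i _.
by rewrite -bilinZl bilin_single.
Qed.

Lemma bilin_singlel u i :
  bilin (single i (1 : k^o)) u = \sum_j (u j : k) *: e i j.
Proof.
rewrite {1}(single_decomp u) bilin_sumr; apply: eq_bigr => j _.
by rewrite -bilinZr bilin_single.
Qed.

Lemma bilinA :
    (forall i j l, bilin (single i 1) (e j l) = bilin (e i j) (single l 1)) ->
  associative bilin.
Proof.
move=> eA u v w.
rewrite (single_decomp u) [X in _ = bilin X _]bilin_suml [LHS]bilin_suml.
rewrite [RHS]bilin_suml; apply: eq_bigr => i _.
rewrite -[LHS]bilinZl -[X in _ = bilin X _]bilinZl -[RHS]bilinZl.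
congr (_ *: _); rewrite (single_decomp v) [X in bilin _ X = _]bilin_suml.
rewrite [X in _ = bilin X _]bilin_sumr [LHS]bilin_sumr [RHS]bilin_suml.
apply: eq_bigr => j _.
rewrite -[X in bilin _ X = _]bilinZl -[X in _ = bilin X _]bilinZr.
rewrite -[LHS]bilinZr -[RHS]bilinZl; congr (_ *: _).
rewrite (single_decomp w) [X in bilin _ X = _]bilin_sumr [LHS]bilin_sumr.
rewrite [RHS]bilin_sumr; apply: eq_bigr => l _.
rewrite -[X in bilin _ X = _]bilinZr -[LHS]bilinZr -[RHS]bilinZr.
by rewrite !bilin_single eA.
Qed.

Lemma bilin1 u0 :
  (forall i, bilin u0 (single i 1) = single i 1) -> left_id u0 bilin.
Proof.
move=> H u; rewrite {1}(single_decomp u) bilin_sumr [RHS]single_decomp.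
by apply: eq_bigr => i _; rewrite -bilinZr H.
Qed.

Lemma bilinr1 u0 :
  (forall i, bilin (single i 1) u0 = single i 1) -> right_id u0 bilin.
Proof.
move=> H u; rewrite {1}(single_decomp u) bilin_suml [RHS]single_decomp.
by apply: eq_bigr => i _; rewrite -bilinZl H.
Qed.

Variables (c : I -> I -> k) (o : I -> I -> I).
Hypothesis eE : forall i j, e i j = c i j *: single (o i j) (1 : k^o).

Lemma bilin_monA :
    (forall i j l, c j l * c i (o j l) = c i j * c (o i j) l) ->
    (forall i j l, c i j * c (o i j) l != 0 -> o i (o j l) = o (o i j) l) ->
  associative bilin.
Proof.
move=> cA oA; apply: bilinA => i j l.
rewrite (eE j l) (eE i j) -bilinZr -bilinZl !bilin_single !eE !scalerA cA.
have [->|/oA ->//] := eqVneq (c i j * c (o i j) l) 0.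
by rewrite !scale0r.
Qed.

End BilinearExtension.

Section Cocycles.
Variables (k : fieldType) (gT : finGroupType).
Local Open Scope group_scope.

Record cocycle2 := Cocycle2 {
  cocycle2_fun :> gT -> gT -> k;
  cocycle2_neq0 : forall x y, cocycle2_fun x y != 0%R;
  cocycle2P : forall x y z,
    (cocycle2_fun x y * cocycle2_fun (x * y)%g z
     = cocycle2_fun y z * cocycle2_fun x (y * z)%g)%R }.

Record cocycle3 := Cocycle3 {
  cocycle3_fun :> gT -> gT -> gT -> k;
  cocycle3_neq0 : forall g h l, cocycle3_fun g h l != 0%R;
  cocycle3P : forall g h l m,
    (cocycle3_fun h l m * cocycle3_fun g (h * l)%g m * cocycle3_fun g h l
     = cocycle3_fun (g * h)%g l m * cocycle3_fun g h (l * m)%g)%R;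
  cocycle3_1l : forall h l, cocycle3_fun 1%g h l = 1%R;
  cocycle3_1m : forall g l, cocycle3_fun g 1%g l = 1%R;
  cocycle3_1r : forall g h, cocycle3_fun g h 1%g = 1%R }.

Variable beta : cocycle3.

(* Recall that g ^ x = x^-1 * g * x. *)
Definition theta (g x y : gT) : k :=
  (beta g x y * beta x y (g ^ (x * y))%g / beta x (g ^ x)%g y)%R.

Lemma theta_neq0 g x y : theta g x y != 0%R.
Proof. by rewrite /theta !mulf_neq0 ?invr_neq0 // cocycle3_neq0. Qed.

Lemma theta1l g y : theta g 1 y = 1%R.
Proof. by rewrite /theta cocycle3_1m !cocycle3_1l invr1 !mulr1. Qed.

Lemma theta1r g x : theta g x 1 = 1%R.
Proof. by rewrite /theta cocycle3_1m !cocycle3_1r invr1 !mulr1. Qed.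

Lemma thetaP g x y z :
  (theta g x y * theta g (x * y)%g z
   = theta (g ^ x)%g y z * theta g x (y * z)%g)%R.
Proof.
rewrite /theta !conjgM.
set g1 := g ^ x; set g2 := g1 ^ y; set g3 := g2 ^ z.
have E1 : (x * g1 = g * x)%g by rewrite /g1 -conjgC.
have E2 : (y * g2 = g1 * y)%g by rewrite /g2 -conjgC.
have E3 : (z * g3 = g2 * z)%g by rewrite /g3 -conjgC.
have H1 := cocycle3P beta g x y z.
have H2 := cocycle3P beta x g1 y z.
have H3 := cocycle3P beta x y g2 z.
have H4 := cocycle3P beta x y z g3.
rewrite E1 in H2; rewrite E2 in H3; rewrite E3 in H4.
apply/eqP; rewrite mulf_div mulf_div eqr_div ?mulf_neq0 ?cocycle3_neq0 //.
apply/eqP.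
have nz : (beta x y z * beta (g * x)%g y z * beta x (g1 * y)%g z
           * beta x y (g2 * z)%g)%R != 0%R by rewrite !mulf_neq0 ?cocycle3_neq0.
apply: (mulfI nz).
have mul4 (a1 a2 a3 a4 b1 b2 b3 b4 : k) : a1 = b1 -> a2 = b2 -> a3 = b3 ->
  a4 = b4 -> (a1 * b2 * a3 * b4 = b1 * a2 * b3 * a4)%R.
  by move=> -> -> -> ->.
have H := mul4 _ _ _ _ _ _ _ _ H1 H2 H3 H4.
transitivity (beta x y z * beta g (x * y)%g z * beta g x y
  * (beta (g * x)%g y z * beta x g1 (y * z)%g)
  * (beta y g2 z * beta x (g1 * y)%g z * beta x y g2)
  * (beta (x * y)%g z g3 * beta x y (g2 * z)%g))%R; first by ring.
by rewrite H; ring.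
Qed.

End Cocycles.

Section Double.
Variables (k : fieldType) (gT : finGroupType).
Implicit Types (beta : cocycle3 k gT) (p q : gT * gT).

(* D^beta(k[G]), with basis element g |_ x at (g, x). *)
Definition Dbeta beta : Type := {ffun gT * gT -> k^o}.

HB.instance Definition _ beta := Vector.copy (Dbeta beta) {ffun gT * gT -> k^o}.

Variable beta : cocycle3 k gT.

Definition dbas (g x : gT) : Dbeta beta := single (g, x) (1 : k^o).

Definition Dbeta_basis_mul p q : {ffun gT * gT -> k^o} :=
  if p.1 == (p.2 * q.1 * p.2^-1)%g
  then theta beta p.1 p.2 q.2 *: dbas p.1 (p.2 * q.2)%g else 0.

Definition Dbeta_mul : Dbeta beta -> Dbeta beta -> Dbeta beta :=
  bilin Dbeta_basis_mul.

Definition Dbeta_one : Dbeta beta := \sum_g dbas g 1%g.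

Lemma Dbeta_basis_mulE p q :
  Dbeta_basis_mul p q
  = (if p.1 == (p.2 * q.1 * p.2^-1)%g then theta beta p.1 p.2 q.2 else 0)
      *: single (p.1, (p.2 * q.2)%g) (1 : k^o).
Proof. by rewrite /Dbeta_basis_mul; case: ifP => // _; rewrite scale0r. Qed.

Lemma conj_eqE (g x h : gT) : (g == (x * h * x^-1)%g) = (h == (g ^ x)%g).
Proof.
apply/eqP/eqP => [->|->]; first by rewrite conjgE !mulgA mulVg mul1g mulgKV.
by rewrite conjgE !mulgA mulgV mul1g mulgK.
Qed.

Fact Dbeta_mulA : associative Dbeta_mul.
Proof.
apply: (bilin_monA Dbeta_basis_mulE) => [[g x] [h y] [l z]|[g x] [h y] [l z]] /=;
  last by rewrite mulgA.
rewrite !conj_eqE conjgM.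
have [->|_] := eqVneq h (g ^ x)%g; last by rewrite mulr0 mul0r.
by case: eqVneq => _; rewrite ?mulr0 ?mul0r // thetaP.
Qed.

Fact Dbeta_mul1l : left_id Dbeta_one Dbeta_mul.
Proof.
apply: bilin1 => -[h y]; rewrite /Dbeta_one bilin_suml (bigD1 h) //=.
rewrite big1 => [|g gh]; rewrite /dbas bilin_single Dbeta_basis_mulE /=.
  by rewrite mul1g invg1 mulg1 eqxx theta1l scale1r mul1g addr0.
by rewrite mul1g invg1 mulg1 (negbTE gh) scale0r.
Qed.

Fact Dbeta_mul1r : right_id Dbeta_one Dbeta_mul.
Proof.
apply: bilinr1 => -[h y]; rewrite /Dbeta_one bilin_sumr (bigD1 (h ^ y)%g) //=.
rewrite big1 => [|g gh]; rewrite /dbas bilin_single Dbeta_basis_mulE /= conj_eqE.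
  by rewrite eqxx theta1r scale1r mulg1 addr0.
by rewrite (negbTE gh) scale0r.
Qed.

Fact Dbeta_one_neq0 : Dbeta_one != 0.
Proof.
apply/eqP => /ffunP/(_ (1%g, 1%g)); rewrite sum_ffunE (bigD1 1%g) //= big1.
  by rewrite !ffunE eqxx addr0 => /eqP; rewrite oner_eq0.
by move=> g g1; rewrite ffunE xpair_eqE eq_sym (negbTE g1).
Qed.

HB.instance Definition _ := GRing.Zmodule_isNzRing.Build (Dbeta beta)
  Dbeta_mulA Dbeta_mul1l Dbeta_mul1r (@bilinDl _ _ _) (@bilinDr _ _ _)
  Dbeta_one_neq0.

HB.instance Definition _ := GRing.Lmodule_isLalgebra.Build k (Dbeta beta)
  (@bilinZl _ _ _).
HB.instance Definition _ := GRing.Lalgebra_isAlgebra.Build k (Dbeta beta)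
  (@bilinZr _ _ _).
HB.instance Definition _ := Algebra_isFalgebra.Build k (Dbeta beta).

Lemma dbas_mul g x h y :
  dbas g x * dbas h y
  = if g == (x * h * x^-1)%g then theta beta g x y *: dbas g (x * y)%g else 0.
Proof. exact: bilin_single. Qed.

Definition comm_basis : seq (Dbeta beta) :=
  [seq dbas p.1 p.2 | p <- enum {: gT * gT} & (p.1 * p.2 == p.2 * p.1)%g].

Fact Dbeta_comm_is_aspace : is_aspace <<comm_basis>>%VS.
Proof.
have bas g x : (g * x = x * g)%g -> dbas g x \in <<comm_basis>>%VS.
  move=> gx; apply: memv_span; apply/mapP; exists (g, x) => //.
  by rewrite mem_filter mem_enum inE /= gx eqxx.
apply/andP; split.
  by apply: has_algid1; apply: rpred_sum => g _; apply: bas; rewrite mul1g mulg1.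
apply/prodvP => u v /(@coord_span _ _ _ (in_tuple comm_basis)) ->.
move=> /(@coord_span _ _ _ (in_tuple comm_basis)) ->.
rewrite mulr_suml; apply: rpred_sum => i _.
rewrite mulr_sumr; apply: rpred_sum => j _.
rewrite -scalerAl -scalerAr; do 2!apply: rpredZ.
have /mapP[[h y]] := mem_nth 0 (ltn_ord j).
rewrite mem_filter => /andP[/eqP /= hy _ ->].
have /mapP[[g x]] := mem_nth 0 (ltn_ord i).
rewrite mem_filter => /andP[/eqP /= gx _ ->].
rewrite dbas_mul conj_eqE; case: eqP => [hE|_]; last exact: mem0v.
apply: rpredZ; apply: bas.
have hg : h = g by rewrite hE conjgE gx mulKg.
by rewrite mulgA gx -!mulgA -hg hy.
Qed.

Canonical Dbeta_comm : {aspace Dbeta beta} := ASpace Dbeta_comm_is_aspace.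

End Double.

Section GSets.
Variables (H : finGroupType) (Y : finType) (to : {action H &-> Y}).

Definition fixed_points (g : H) : Type := {y : Y | to y g == y}.
HB.instance Definition _ g := Finite.on (fixed_points g).

(* The disjoint union over m of the Y^m. *)
Definition inertia : Type := {p : H * Y | to p.2 p.1 == p.2}.
HB.instance Definition _ := SubFinite.on inertia.

Fact fixed_act_subproof g (y : fixed_points g) (z : subg_of 'C[g]) :
  to (to (sval y) (val z)) g == to (sval y) (val z).
Proof.
have /cent1P zg := valP z.
by rewrite -actM /= zg actM (eqP (svalP y)).
Qed.

Definition fixed_act_fun g (y : fixed_points g) (z : subg_of 'C[g]) :
  fixed_points g := exist (fun x => to x g == x) _ (fixed_act_subproof y z).

Fact fixed_act1 g : @fixed_act_fun g ^~ 1%g =1 id.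
Proof. by move=> y; apply: val_inj; rewrite /= act1. Qed.

Fact fixed_actM g (y : fixed_points g) : act_morph (@fixed_act_fun g) y.
Proof. by move=> z w; apply: val_inj; rewrite /= actM. Qed.

Definition fixed_act g : {action subg_of 'C[g] &-> fixed_points g} :=
  TotalAction (@fixed_act1 g) (@fixed_actM g).

End GSets.

Section GlobalK.
Variables (k : fieldType) (H : finGroupType) (Y : finType).

(* K^alpha_global(Y, H) for a zero-dimensional H-variety, i.e. a finite H-set.
   With coefficients in k, the K-theory of a finite set S is the algebra of
   functions S -> k, so the direct sum of the K(Y^m) consists of the functions
   on the inertia set.  Actions are right actions here; passing from a left
   action to a right one by inversion does not change the fixed point sets.  The
   point y0 only witnesses that Y is nonempty, so that the ring is not zero, as
   the library requires of its algebras. *)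
Definition Kglobal (alpha : cocycle2 k H) (to : {action H &-> Y}) (y0 : Y) :
  Type := {ffun inertia to -> k^o}.

HB.instance Definition _ alpha to y0 :=
  Vector.copy (@Kglobal alpha to y0) {ffun inertia to -> k^o}.

Variables (alpha : cocycle2 k H) (to : {action H &-> Y}) (y0 : Y).
Notation K := (Kglobal alpha to y0).
Implicit Types (v w : K) (p q r : inertia to).

(* In dimension zero the obstruction and normal bundles vanish, and the stringy
   product of v in K(Y^m1) and w in K(Y^m2) is obtained by restricting v and w
   to the common fixed points of m1 and m2, multiplying, and pushing forward
   (that is, extending by zero) to Y^(m1 m2). *)
Definition Kmul v w : K :=
  [ffun p => \sum_(q | (val q).2 == (val p).2)
             \sum_(r | ((val r).2 == (val p).2)
                        && ((val q).1 * (val r).1 == (val p).1)%g)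
               alpha (val q).1 (val r).1 * ((v q : k) * (w r : k))].

(* alpha is not assumed to be normalized, whence the scalar. *)
Definition Kone : K :=
  [ffun p => if (val p).1 == 1%g then (alpha 1%g 1%g)^-1 else 0].

(* The structure sheaf of Y^m, as an element of the m-th summand. *)
Definition Ksector (m : H) : K := [ffun p => if (val p).1 == m then 1 else 0].

Definition Kcoef q r : k :=
  if (val q).2 == (val r).2 then alpha (val q).1 (val r).1 else 0.
Definition Kidx q r : inertia to :=
  insubd q ((val q).1 * (val r).1, (val q).2)%g.

Lemma KidxE q r : (val q).2 = (val r).2 ->
  val (Kidx q r) = ((val q).1 * (val r).1, (val q).2)%g.
Proof.
move=> qr; rewrite val_insubd /= actM (eqP (valP q)) qr.
by rewrite (eqP (valP r)) eqxx.
Qed.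

Definition Kbasis_mul q r : {ffun inertia to -> k^o} :=
  Kcoef q r *: single (Kidx q r) (1 : k^o).

Lemma Kbasis_mulE q r p :
  Kbasis_mul q r p =
  if [&& (val q).2 == (val p).2, (val r).2 == (val p).2
       & ((val q).1 * (val r).1 == (val p).1)%g]
  then alpha (val q).1 (val r).1 else 0.
Proof.
rewrite !ffunE /Kcoef; case: eqVneq => [qr|qr].
  rewrite -val_eqE KidxE // -qr [val p]surjective_pairing xpair_eqE /=.
  rewrite ![_ == (val p).1]eq_sym ![_ == (val p).2]eq_sym.
  by case: eqP; case: eqP => //= *; rewrite /GRing.scale /= (mulr1, mulr0).
rewrite scale0r; case: eqP => //= qp; case: eqP => //= rp.
by case/eqP: qr; rewrite qp rp.
Qed.

Lemma KmulE v w : Kmul v w = bilin Kbasis_mul v w.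
Proof.
apply/ffunP => p; rewrite ffunE /bilin sum_ffunE [RHS](bigID (fun q => (val q).2 == (val p).2)) /=.
rewrite [X in _ + X]big1 ?addr0 => [|q qp]; last first.
  rewrite sum_ffunE big1 // => r _.
  by rewrite ffunE Kbasis_mulE (negbTE qp) scaler0.
apply: eq_bigr => q qp; rewrite sum_ffunE big_mkcond; apply: eq_bigr => r _.
rewrite [RHS]ffunE Kbasis_mulE qp /=; case: ifP => _; last by rewrite scaler0.
by rewrite mulrC.
Qed.

Fact KmulA : associative Kmul.
Proof.
have cE q r l : Kcoef q r * Kcoef (Kidx q r) l =
   if ((val q).2 == (val r).2) && ((val q).2 == (val l).2) then
     alpha (val q).1 (val r).1 * alpha ((val q).1 * (val r).1)%g (val l).1 else 0.
  rewrite /Kcoef; case: eqVneq => [qr|] /=; last by rewrite mul0r.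
  by rewrite KidxE //=; case: ifP => //; rewrite mulr0.
move=> u v w; rewrite !KmulE; apply: bilin_monA u v w => // q r l.
  rewrite cE {1}/Kcoef; have [rl|rl] := eqVneq (val r).2 (val l).2; last first.
    rewrite mul0r; case: eqP => //= qr; case: eqP => //= ql.
    by case/eqP: rl; rewrite -qr.
  rewrite /Kcoef KidxE //=; case: eqVneq => [qr|] /=; last by rewrite mulr0.
  by rewrite qr rl ?eqxx cocycle2P.
rewrite cE; have [qr|] := eqVneq (val q).2 (val r).2; last by rewrite eqxx.
have [ql _|] := eqVneq (val q).2 (val l).2; last by rewrite eqxx.
have rl : (val r).2 = (val l).2 by rewrite -qr.
by apply: val_inj; rewrite !KidxE ?mulgA.
Qed.

Lemma alpha1l x : alpha 1%g x = alpha 1%g 1%g.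
Proof.
have := cocycle2P alpha 1%g 1%g x; rewrite !mul1g => /esym.
by move/(mulIf (cocycle2_neq0 alpha 1%g x)).
Qed.

Lemma alpha1r x : alpha x 1%g = alpha 1%g 1%g.
Proof.
have := cocycle2P alpha x 1%g 1%g; rewrite !mulg1.
by move/(mulIf (cocycle2_neq0 alpha x 1%g)).
Qed.

Fact inertia1_subproof (y : Y) : to y 1%g == y.
Proof. by rewrite act1. Qed.

Definition inertia1 (y : Y) : inertia to :=
  exist (fun p : H * Y => to p.2 p.1 == p.2) (1%g, y) (inertia1_subproof y).

Fact Kmul1l : left_id Kone Kmul.
Proof.
move=> v; rewrite KmulE; move: v; apply: bilin1 => r.
rewrite bilin_singler (bigD1 (inertia1 (val r).2)) //= big1 => [|q].
  rewrite ffunE eqxx addr0 /Kbasis_mul /Kcoef eqxx alpha1l scalerA.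
  rewrite mulVf ?cocycle2_neq0 // scale1r; congr single; apply: val_inj.
  by rewrite KidxE //= mul1g -surjective_pairing.
rewrite ffunE -val_eqE [val q]surjective_pairing xpair_eqE /=.
case: eqP => /= [_ qr|]; last by rewrite scale0r.
by rewrite /Kbasis_mul /Kcoef (negbTE qr) scale0r scaler0.
Qed.

Fact Kmul1r : right_id Kone Kmul.
Proof.
move=> v; rewrite KmulE; move: v; apply: bilinr1 => r.
rewrite bilin_singlel (bigD1 (inertia1 (val r).2)) //= big1 => [|q].
  rewrite ffunE eqxx addr0 /Kbasis_mul /Kcoef eqxx alpha1r scalerA.
  rewrite mulVf ?cocycle2_neq0 // scale1r; congr single; apply: val_inj.
  by rewrite KidxE //= mulg1 -surjective_pairing.
rewrite ffunE -val_eqE [val q]surjective_pairing xpair_eqE /=.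
case: eqP => /= [_ qr|]; last by rewrite scale0r.
by rewrite /Kbasis_mul /Kcoef eq_sym (negbTE qr) scale0r scaler0.
Qed.

Fact KmulDl : left_distributive Kmul +%R.
Proof. by move=> u v w; rewrite !KmulE bilinDl. Qed.
Fact KmulDr : right_distributive Kmul +%R.
Proof. by move=> u v w; rewrite !KmulE bilinDr. Qed.
Fact KmulZl a u v : a *: Kmul u v = Kmul (a *: u) v.
Proof. by rewrite !KmulE bilinZl. Qed.
Fact KmulZr a u v : a *: Kmul u v = Kmul u (a *: v).
Proof. by rewrite !KmulE bilinZr. Qed.

Fact Kone_neq0 : Kone != 0.
Proof.
apply/eqP => /ffunP/(_ (inertia1 y0)); rewrite !ffunE eqxx => /eqP.
by rewrite invr_eq0; apply/negP; apply: cocycle2_neq0.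
Qed.

HB.instance Definition _ := GRing.Zmodule_isNzRing.Build K
  KmulA Kmul1l Kmul1r KmulDl KmulDr Kone_neq0.
HB.instance Definition _ := GRing.Lmodule_isLalgebra.Build k K KmulZl.
HB.instance Definition _ := GRing.Lalgebra_isAlgebra.Build k K KmulZr.
HB.instance Definition _ := Algebra_isFalgebra.Build k K.

End GlobalK.

Section DirectSums.
Variables (k : fieldType) (gT : finGroupType).

Section Modules.
Variable V : gT -> lmodType k.

Definition dirsum : Type := {dffun forall g, V g}.

Implicit Types u v w : dirsum.

Let add u v : dirsum := [ffun g => (u g + v g : V g)].
Let zero : dirsum := [ffun g => (0 : V g)].
Let opp u : dirsum := [ffun g => (- u g : V g)].
Let scale (a : k) u : dirsum := [ffun g => (a *: u g : V g)].

HB.instance Definition _ := Choice.copy dirsum {dffun forall g, V g}.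

Fact dirsum_addA : associative add.
Proof. by move=> u v w; apply/ffunP => g; rewrite !ffunE addrA. Qed.
Fact dirsum_addC : commutative add.
Proof. by move=> u v; apply/ffunP => g; rewrite !ffunE addrC. Qed.
Fact dirsum_add0 : left_id zero add.
Proof. by move=> u; apply/ffunP => g; rewrite !ffunE add0r. Qed.
Fact dirsum_addN : left_inverse zero opp add.
Proof. by move=> u; apply/ffunP => g; rewrite !ffunE addNr. Qed.

HB.instance Definition _ := GRing.isZmodule.Build dirsum
  dirsum_addA dirsum_addC dirsum_add0 dirsum_addN.

Fact dirsum_scaleA a b v : scale a (scale b v) = scale (a * b) v.
Proof. by apply/ffunP => g; rewrite !ffunE scalerA. Qed.
Fact dirsum_scale1 : left_id 1 scale.
Proof. by move=> v; apply/ffunP => g; rewrite !ffunE scale1r. Qed.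
Fact dirsum_scaleDr : right_distributive scale +%R.
Proof. by move=> a u v; apply/ffunP => g; rewrite !ffunE scalerDr. Qed.
Fact dirsum_scaleDl v : {morph scale^~ v : a b / a + b}.
Proof. by move=> a b; apply/ffunP => g; rewrite !ffunE scalerDl. Qed.

HB.instance Definition _ := GRing.Zmodule_isLmodule.Build k dirsum
  dirsum_scaleA dirsum_scale1 dirsum_scaleDr dirsum_scaleDl.

Definition dirsum_in (g : gT) (v : V g) : dirsum :=
  finfun (dfwith (fun h => 0 : V h) v).

End Modules.

Section Algebras.
Variable A : gT -> algType k.

(* The same module for a family of algebras, with componentwise product. *)
Definition dirsum_alg : Type := dirsum (fun g => A g).

HB.instance Definition _ :=
  GRing.Lmodule.copy dirsum_alg (dirsum (fun g => A g)).

Implicit Types u v w : dirsum_alg.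
Let mul u v : dirsum_alg := [ffun g => (u g * v g : A g)].
Let one : dirsum_alg := [ffun g => (1 : A g)].

Fact dirsum_mulA : associative mul.
Proof. by move=> u v w; apply/ffunP => g; rewrite !ffunE mulrA. Qed.
Fact dirsum_mul1l : left_id one mul.
Proof. by move=> u; apply/ffunP => g; rewrite !ffunE mul1r. Qed.
Fact dirsum_mul1r : right_id one mul.
Proof. by move=> u; apply/ffunP => g; rewrite !ffunE mulr1. Qed.
Fact dirsum_mulDl : left_distributive mul +%R.
Proof. by move=> u v w; apply/ffunP => g; rewrite !ffunE mulrDl. Qed.
Fact dirsum_mulDr : right_distributive mul +%R.
Proof. by move=> u v w; apply/ffunP => g; rewrite !ffunE mulrDr. Qed.
Fact dirsum_one_neq0 : one != 0.
Proof.
by apply/eqP => /ffunP/(_ 1%g); rewrite !ffunE => /eqP; rewrite oner_eq0.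
Qed.

HB.instance Definition _ := GRing.Zmodule_isNzRing.Build dirsum_alg
  dirsum_mulA dirsum_mul1l dirsum_mul1r dirsum_mulDl dirsum_mulDr
  dirsum_one_neq0.

Fact dirsum_mulZl a u v : a *: (u * v) = (a *: u) * v.
Proof. by apply/ffunP => g; rewrite !ffunE scalerAl. Qed.
HB.instance Definition _ :=
  GRing.Lmodule_isLalgebra.Build k dirsum_alg dirsum_mulZl.

Fact dirsum_mulZr a u v : a *: (u * v) = u * (a *: v).
Proof. by apply/ffunP => g; rewrite !ffunE scalerAr. Qed.
HB.instance Definition _ :=
  GRing.Lalgebra_isAlgebra.Build k dirsum_alg dirsum_mulZr.

End Algebras.
End DirectSums.

Section InertiaK.
Variables (k : fieldType) (gT : finGroupType) (beta : cocycle3 k gT).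
Local Notation Z g := (subg_of 'C[g]).

Fact theta_cent_subproof g (x y z : Z g) :
  theta beta g (val x) (val y) * theta beta g (val (x * y)%g) (val z)
  = theta beta g (val y) (val z) * theta beta g (val x) (val (y * z)%g).
Proof.
have /cent1P xg := valP x.
by rewrite /= thetaP conjgE -xg mulKg.
Qed.

Definition theta_cent g : cocycle2 k (Z g) :=
  @Cocycle2 k (Z g) (fun x y => theta beta g (val x) (val y))
    (fun x y => theta_neq0 beta g (val x) (val y)) (@theta_cent_subproof g).

(* K^beta_global(I(X, G), G); the points w g witness that the X^g are
   nonempty. *)
Definition Kinertia (X : finType) (to : {action gT &-> X})
    (w : forall g, fixed_points to g) :=
  dirsum_alg (fun g => Kglobal (theta_cent g) (fixed_act to g) (w g)).

Definition pt_act : {action gT &-> unit} :=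
  @TotalAction gT unit (fun x _ => x) (fun=> erefl) (fun _ _ _ => erefl).

Definition pt_fixed g : fixed_points pt_act g :=
  exist (fun x => pt_act x g == x) tt (eqxx tt).

Definition Kpt g := Kglobal (theta_cent g) (fixed_act pt_act g) (pt_fixed g).

Definition Kinertia_pt := Kinertia pt_fixed.

(* The basis element v_m of the g-summand. *)
Definition Kpt_basis g (m : Z g) : Kinertia_pt :=
  dirsum_in (V := fun g => Kpt g) (Ksector _ _ _ m).

End InertiaK.

Section Quotients.
Variables (k : fieldType) (V : vectType k) (U : {vspace V}).

(* V / U, realized on the complement U^C of U; see quot_class_eq0 and
   quot_class_val. *)
Definition quotv : vectType k := subvs_of (U^C)%VS.

Definition quot_class (v : V) : quotv := vsproj (U^C)%VS (v - projv U v).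

Fact quot_class_is_linear : linear quot_class.
Proof.
move=> a u v; rewrite /quot_class -linearP; congr (vsproj _ _).
by rewrite linearP opprD addrACA scalerBr.
Qed.

HB.instance Definition _ :=
  GRing.isLinear.Build k V quotv _ quot_class quot_class_is_linear.

Lemma quot_class_subproof v : v - projv U v \in (U^C)%VS.
Proof.
have {1}<- := @daddv_pi_add _ _ U (U^C)%VS v (capv_compl U) _.
  by rewrite addrC addKr memv_pi.
by rewrite addv_complf memvf.
Qed.

Lemma quot_class_eq0 v : (quot_class v == 0) = (v \in U).
Proof.
apply/eqP/idP => [/(congr1 vsval) | Uv]; last first.
  by rewrite /quot_class projv_id // subrr linear0.
rewrite /quot_class vsprojK ?quot_class_subproof // linear0 => /eqP.
by rewrite subr_eq0 => /eqP->; apply: memv_proj.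
Qed.

Lemma quot_class_val (w : quotv) : quot_class (vsval w) = w.
Proof.
have w0 : vsval w - (vsval w - projv U (vsval w)) \in (U :&: U^C)%VS.
  rewrite memv_cap; apply/andP; split; last first.
    by rewrite rpredB ?quot_class_subproof ?subvsP.
  by rewrite opprB addrC subrK memv_proj.
move: w0; rewrite capv_compl memv0 subr_eq0 => /eqP w0.
by rewrite /quot_class -w0 vsvalK.
Qed.

End Quotients.

Section DPR.
Variables (k : fieldType) (gT : finGroupType) (beta : cocycle3 k gT).
Local Notation Z g := (subg_of 'C[g]).

(* The input of DPR induction: algebras B_g together with isomorphisms
   B_g = k^(theta_g)[Z(g)] (x) B_e. The construction does not involve the
   Frobenius forms, nor the action of G on B_e. *)
Record free_family := FreeFamily {
  ffB : gT -> falgType k;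
  ffE : algType k;
  ffI : forall g, {linear {ffun Z g -> ffE} -> ffB g};
  ffJ : forall g, ffB g -> {ffun Z g -> ffE};
  ffIK : forall g, cancel (ffI g) (@ffJ g);
  ffJK : forall g, cancel (@ffJ g) (ffI g);
  ffI1 : forall g, ffI g (single 1%g 1) = 1;
  ffIM : forall g (z w : Z g) (b c : ffE),
    ffI g (single z b) * ffI g (single w c)
    = theta beta g (val z) (val w) *: ffI g (single (z * w)%g (b * c)) }.

Definition ff_alg (A : free_family) : algType k := dirsum_alg (fun g => ffB A g).

Variable A : free_family.
Local Notation E := (ffE A).

(* k[G] (x) B_g is {ffun gT -> B_g}; its quotient by the span of the
   (x.z) (x) v - x (x) (z v) is the tensor product over k^(theta_g)[Z(g)]. *)
Definition dpr_rel g (x : gT) (z : Z g) (v : ffB A g) : {ffun gT -> ffB A g} :=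
  theta beta (x * g * x^-1)%g x (val z) *: single (x * val z)%g v
  - single x (ffI A g (single z 1) * v).

Definition dpr_relations g : {vspace {ffun gT -> ffB A g}} :=
  (\sum_(x : gT) \sum_(z : Z g)
     <<[seq dpr_rel x z v | v <- vbasis {:ffB A g}]>>)%VS.

Definition Ind_DPR : Type := dirsum (fun g => quotv (dpr_relations g)).
HB.instance Definition _ := GRing.Lmodule.on Ind_DPR.

(* The class of r (x) v in the g-summand. *)
Definition dpr_tensor g (r : gT) (v : ffB A g) : Ind_DPR :=
  dirsum_in (V := fun g => quotv (dpr_relations g))
    (quot_class (dpr_relations g) (single r v)).

(* D^beta(k[G]) (x) B_e with the factorwise product. *)
Definition DbetaE := {ffun gT * gT -> E}.

Definition DbetaE_tensor (d : Dbeta beta) (b : E) : DbetaE :=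
  [ffun p => (d p : k) *: b].

Definition DbetaE_mul (u v : DbetaE) : DbetaE :=
  \sum_p \sum_q
    DbetaE_tensor (dbas beta p.1 p.2 * dbas beta q.1 q.2) (u p * v q).

Definition DbetaE_one : DbetaE := DbetaE_tensor 1 1.

(* (h |_ x) (x) b corresponds to x (x) (1 (x) b) in the summand of x^-1 h x;
   conversely r (x) (z (x) b) = r.z (x) (1 (x) b) in the g-summand corresponds
   to theta_(r g r^-1)(r, z) (r g r^-1 |_ r z) (x) b. *)
Definition dpr_of_double (w : DbetaE) : Ind_DPR :=
  finfun (fun g => quot_class (dpr_relations g)
    [ffun r => ffI A g (single 1%g (w ((r * g * r^-1)%g, r)))]).

Definition dpr_to_double (u : Ind_DPR) : DbetaE :=
  \sum_g \sum_r \sum_(z : Z g)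
    single ((r * g * r^-1)%g, (r * val z)%g)
      (theta beta (r * g * r^-1)%g r (val z) *: ffJ (vsval (u g) r) z).

Definition dpr_mul (u v : Ind_DPR) : Ind_DPR :=
  dpr_of_double (DbetaE_mul (dpr_to_double u) (dpr_to_double v)).

Definition dpr_one : Ind_DPR := dpr_of_double DbetaE_one.

End DPR.

Section PointFamily.
Variables (k : fieldType) (gT : finGroupType) (beta : cocycle3 k gT).
Local Notation Z g := (subg_of 'C[g]).
Local Notation K g := (Kpt beta g).

Definition Kpt_I g (u : {ffun Z g -> k^o}) : K g := [ffun p => u (val p).1].

Definition Kpt_point g (z : Z g) : inertia (fixed_act (@pt_act gT) g) :=
  exist (fun p => fixed_act (@pt_act gT) g p.2 p.1 == p.2) (z, pt_fixed g)
    (eqxx (pt_fixed g)).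

Definition Kpt_J g (v : K g) : {ffun Z g -> k^o} := [ffun z => v (Kpt_point z)].

Fact Kpt_I_is_linear g : linear (@Kpt_I g).
Proof. by move=> a u v; apply/ffunP => p; rewrite !ffunE. Qed.

HB.instance Definition _ g :=
  GRing.isLinear.Build k {ffun Z g -> k^o} (K g) _ (@Kpt_I g)
    (@Kpt_I_is_linear g).

Lemma pt_inertiaE g (p : inertia (fixed_act (@pt_act gT) g)) :
  p = Kpt_point (val p).1.
Proof.
apply: val_inj; rewrite /= [LHS]surjective_pairing; congr pair.
by apply: val_inj; case: (val _).
Qed.

Fact Kpt_IK g : cancel (@Kpt_I g) (@Kpt_J g).
Proof. by move=> u; apply/ffunP => z; rewrite !ffunE. Qed.

Fact Kpt_JK g : cancel (@Kpt_J g) (@Kpt_I g).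
Proof. by move=> v; apply/ffunP => p; rewrite !ffunE -pt_inertiaE. Qed.

Fact Kpt_I1 g : Kpt_I (single (1%g : Z g) (1 : k^o)) = 1.
Proof.
apply/ffunP => p; rewrite !ffunE; case: eqP => // _.
by rewrite /= theta1l invr1.
Qed.

Fact Kpt_I_single g (z : Z g) (b : k^o) :
  Kpt_I (single z b) = b *: (single (Kpt_point z) (1 : k^o) : K g).
Proof.
apply/ffunP => p; rewrite !ffunE.
have -> : (p == Kpt_point z) = ((val p).1 == z).
  by apply/eqP/eqP => [-> // | <-]; apply: pt_inertiaE.
by case: eqP => _; rewrite /GRing.scale /= (mulr1, mulr0).
Qed.

Fact Kpt_IM g (z w : Z g) (b c : k^o) :
  Kpt_I (single z b) * Kpt_I (single w c)
  = theta beta g (val z) (val w) *: Kpt_I (single (z * w)%g (b * c)).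
Proof.
rewrite !Kpt_I_single -scalerAl -scalerAr !scalerA [in RHS]mulrC.
rewrite -[in RHS]scalerA; congr (_ *: _).
rewrite [LHS]KmulE bilin_single /Kbasis_mul /Kcoef eqxx; congr (_ *: single _ _).
by rewrite [LHS]pt_inertiaE KidxE.
Qed.

(* K^beta_global(I(pt, G), G), with B_e = K(pt) = k. *)
Definition Kinertia_family : free_family beta :=
  FreeFamily (ffE := k^o) (ffI := fun g => @Kpt_I g)
    Kpt_IK Kpt_JK Kpt_I1 Kpt_IM.

Fact Kinertia_familyE : ff_alg Kinertia_family = Kinertia_pt beta :> Type.
Proof. by []. Qed.

End PointFamily.

(* Main.v *)
Require Import Defs.
From HB Require Import structures.
From mathcomp Require Import all_boot all_order all_fingroup all_algebra.
From mathcomp Require Import falgebra.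

Set Implicit Arguments.
Unset Strict Implicit.
Unset Printing Implicit Defensive.

Import GRing.Theory.
Local Open Scope ring_scope.

(** The first isomorphism sends v_m in the g-summand to g |_ m.  In D^beta, the
    basis elements g |_ m and h |_ n with m in Z(g), n in Z(h) multiply to 0
    unless g = h, and by theta_g(m, n) g |_ mn otherwise, so the commuting part
    of D^beta is the direct product of the twisted group rings.

    For the second, r (x) (z (x) b) in the g-summand is sent to
    theta_(r g r^-1)(r, z) (r g r^-1 |_ r z) (x) b.  The cocycle identity for
    theta says exactly that the relations of the tensor product are killed;
    modulo these relations every tensor is a sum of the r (x) (1 (x) b), and
    (g, r) |-> (r g r^-1, r) is a bijection of G x G, whence the inverse. *)

(** * Linear algebra: spanning families, functions on a finite set, quotients *)

Lemma span_eq (k : fieldType) (V : vectType k) (W : lmodType k)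
    (f g : {linear V -> W}) (X : seq V) :
  {in X, f =1 g} -> {in <<X>>%VS, f =1 g}.
Proof.
move=> fg v /(@coord_span _ _ _ (in_tuple X)) ->; rewrite !linear_sum.
by apply: eq_bigr => i _; rewrite !linearZ fg ?mem_nth.
Qed.

Section Single.
Variables (k : fieldType) (I : finType).

Lemma single_is_linear (V : lmodType k) (i : I) :
  linear (@single I V i : V -> {ffun I -> V}).
Proof.
move=> a u v; apply/ffunP => j; rewrite !ffunE.
by case: eqP; rewrite ?scaler0 ?addr0.
Qed.
HB.instance Definition _ (V : lmodType k) (i : I) :=
  GRing.isLinear.Build k V {ffun I -> V} _ (@single I V i)
    (@single_is_linear V i).

Lemma sum_single (V : lmodType k) (u : {ffun I -> V}) :
  u = \sum_i single i (u i).
Proof.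
apply/ffunP => j; rewrite sum_ffunE (bigD1 j) //= big1 => [|i ij].
  by rewrite ffunE eqxx addr0.
by rewrite ffunE eq_sym (negbTE ij).
Qed.

End Single.

Lemma sum_dirsum_in (k : fieldType) (gT : finGroupType)
    (V : gT -> lmodType k) (W : nmodType) (F : forall g, V g -> W) g (v : V g) :
  (forall h, F h 0 = 0) -> \sum_h F h (dirsum_in v h) = F g v.
Proof.
move=> F0; rewrite (bigD1 g) //= big1 => [|h hg].
  by rewrite ffunE dfwith_in addr0.
by rewrite ffunE dfwith_out // eq_sym.
Qed.

Lemma quot_class_eq (k : fieldType) (V : vectType k) (U : {vspace V})
    (v w : V) :
  v - w \in U -> quot_class U v = quot_class U w.
Proof. by rewrite -quot_class_eq0 linearB subr_eq0 => /eqP. Qed.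

(** The representative chosen by [vsval] changes [v] only by an element of [U], so a linear map
    killing [U] may be evaluated on that representative. *)
Lemma vsval_quot_class (k : fieldType) (V : vectType k) (U : {vspace V})
    (v : V) :
  v - vsval (quot_class U v) \in U.
Proof. by rewrite -quot_class_eq0 linearB /= quot_class_val subrr. Qed.

(** * The twisted group rings of the centralizers inside D^beta *)

Section PointAlgebra.
Variables (k : fieldType) (gT : finGroupType) (beta : cocycle3 k gT).
Local Notation Z g := (subg_of 'C[g]).
Local Notation K g := (Kpt beta g).

(** The first isomorphism on a single summand; as every element of Z(g) fixes the point, the points
    [Kpt_point z] exhaust the inertia set. *)
Definition sector_to_double g (v : K g) : Dbeta beta :=
  \sum_(z : Z g) (v (Kpt_point z) : k) *: dbas beta g (val z).

Lemma sector_to_double_is_linear g : linear (@sector_to_double g).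
Proof.
move=> a u v; rewrite scaler_sumr -big_split; apply: eq_bigr => z _.
by rewrite !ffunE scalerDl scalerA.
Qed.
HB.instance Definition _ g :=
  GRing.isLinear.Build k (K g) (Dbeta beta) _ (@sector_to_double g)
    (@sector_to_double_is_linear g).

Lemma sector_to_double_diag g (v : K g) (z : Z g) :
  sector_to_double v (g, val z) = v (Kpt_point z).
Proof.
rewrite sum_ffunE (bigD1 z) //= big1 => [|w wz];
  rewrite !ffunE xpair_eqE eqxx /=.
  by rewrite eqxx addr0 /GRing.scale /= mulr1.
by rewrite (inj_eq val_inj) eq_sym (negbTE wz) scaler0.
Qed.

Lemma sector_to_double_off g (v : K g) h x :
  h != g -> sector_to_double v (h, x) = 0.
Proof.
move=> hg; rewrite sum_ffunE big1 // => w _.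
by rewrite !ffunE xpair_eqE (negbTE hg) scaler0.
Qed.

Lemma sector_to_double_single g (z : Z g) (b : k^o) :
  sector_to_double (Kpt_I beta (single z b)) = (b : k) *: dbas beta g (val z).
Proof.
rewrite /sector_to_double (bigD1 z) //= big1 ?addr0 => [|w wz].
  by rewrite !ffunE eqxx.
by rewrite !ffunE /= (negbTE wz) scale0r.
Qed.

Lemma sector_expand g (v : K g) :
  v = \sum_(z : Z g) (v (Kpt_point z) : k) *: Kpt_I beta (single z (1 : k^o)).
Proof.
rewrite -[LHS]Kpt_JK [in LHS](sum_single (Kpt_J v)) linear_sum.
apply: eq_bigr => z _; rewrite ffunE -linearZ; congr Kpt_I.
by rewrite -linearZ; congr single; rewrite /GRing.scale /= mulr1.
Qed.

(** Conjugation by an element of Z(g) fixes g, so the delta condition in the product of D^beta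
    reduces to h = g. *)
Lemma dbas_mul_cent g h (z : Z g) (w : Z h) :
  dbas beta g (val z) * dbas beta h (val w)
  = if h == g then theta beta g (val z) (val w) *: dbas beta g (val z * val w)%g
    else 0.
Proof.
have /cent1P zg := valP z.
by rewrite dbas_mul conj_eqE conjgE -zg mulKg.
Qed.

(** By bilinearity it suffices to compare basis elements, and both products are then the twisted
    group ring law given by theta_g. *)
Lemma sector_to_doubleM g (u v : K g) :
  sector_to_double (u * v) = sector_to_double u * sector_to_double v.
Proof.
rewrite (sector_expand u) (sector_expand v).
rewrite mulr_suml !linear_sum mulr_suml; apply: eq_bigr => z _.
rewrite mulr_sumr linear_sum mulr_sumr; apply: eq_bigr => w _.
rewrite -scalerAl -scalerAr !linearZ -scalerAl -scalerAr; do 2!congr (_ *: _).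
rewrite /= Kpt_IM linearZ /= !sector_to_double_single mulr1 !scale1r.
by rewrite dbas_mul_cent eqxx.
Qed.

Lemma sector_to_doubleM0 g h (u : K g) (v : K h) :
  h != g -> sector_to_double u * sector_to_double v = 0.
Proof.
move=> hg; rewrite mulr_suml big1 // => z _; rewrite mulr_sumr big1 // => w _.
by rewrite -scalerAl -scalerAr dbas_mul_cent (negbTE hg) !scaler0.
Qed.

(** * The direct sum of the twisted group rings inside D^beta *)

Definition inertia_to_double (u : Kinertia_pt beta) : Dbeta beta :=
  \sum_g sector_to_double (u g).

(** This keeps the coefficients at commuting pairs and forgets all others, so it can invert
    [inertia_to_double] only on the commuting part. *)
Definition double_to_inertia (d : Dbeta beta) : Kinertia_pt beta :=
  finfun (fun g => [ffun p => d (g, val (val p).1)] : K g).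

Lemma inertia_to_double_is_linear : linear inertia_to_double.
Proof.
move=> a u v; rewrite /inertia_to_double scaler_sumr -big_split.
by apply: eq_bigr => g _; rewrite !ffunE linearP.
Qed.
HB.instance Definition _ :=
  GRing.isLinear.Build k (Kinertia_pt beta) (Dbeta beta) _ inertia_to_double
    inertia_to_double_is_linear.

Lemma double_to_inertia_is_linear : linear double_to_inertia.
Proof.
move=> a u v; apply/ffunP => g; rewrite !ffunE.
by apply/ffunP => p; rewrite !ffunE.
Qed.
HB.instance Definition _ :=
  GRing.isLinear.Build k (Dbeta beta) (Kinertia_pt beta) _ double_to_inertia
    double_to_inertia_is_linear.

Lemma inertia_to_doubleE u g (z : Z g) :
  inertia_to_double u (g, val z) = u g (Kpt_point z).
Proof.
rewrite sum_ffunE (bigD1 g) //= sector_to_double_diag big1 ?addr0 // => h hg.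
by rewrite sector_to_double_off // eq_sym.
Qed.

Lemma inertia_to_doubleK : cancel inertia_to_double double_to_inertia.
Proof.
move=> u; apply/ffunP => g; rewrite ffunE; apply/ffunP => p.
by rewrite ffunE inertia_to_doubleE -pt_inertiaE.
Qed.

Lemma inertia_to_double_basis g (m : Z g) :
  inertia_to_double (Kpt_basis beta m) = dbas beta g (val m).
Proof.
rewrite /inertia_to_double (sum_dirsum_in (F := @sector_to_double)); last first.
  by move=> h; rewrite linear0.
rewrite -[RHS]scale1r -sector_to_double_single; congr sector_to_double.
by apply/ffunP => p; rewrite !ffunE.
Qed.

Lemma dbas_comm_mem g x :
  (g * x = x * g)%g -> dbas beta g x \in Dbeta_comm beta.
Proof.
move=> gx; apply: memv_span; apply/mapP; exists (g, x) => //.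
by rewrite mem_filter mem_enum inE /= gx eqxx.
Qed.

Lemma inertia_to_double_comm u : inertia_to_double u \in Dbeta_comm beta.
Proof.
apply: rpred_sum => g _; apply: rpred_sum => z _; apply/rpredZ/dbas_comm_mem.
by have /cent1P := valP z.
Qed.

(** Only the spanning family needs checking. Each of its members is the image of some [Kpt_basis],
    where the cancellation already proved on the other side applies. *)
Lemma double_to_inertiaK :
  {in Dbeta_comm beta, cancel double_to_inertia inertia_to_double}.
Proof.
apply: (span_eq (f := inertia_to_double \o double_to_inertia) (g := idfun)).
move=> _ /mapP[[g x] + ->]; rewrite mem_filter => /andP[/eqP /= gx _].
have xg : (x \in 'C[g])%g by apply/cent1P.
rewrite -[x]/(val (Sub x xg : Z g)) -inertia_to_double_basis.
by rewrite inertia_to_doubleK.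
Qed.

(** The unit of the g-summand is v_e, which goes to g |_ e; these add up to [Dbeta_one]. *)
Lemma inertia_to_double1 : inertia_to_double 1 = 1.
Proof.
apply: eq_bigr => g _; rewrite ffunE.
transitivity (sector_to_double (Kpt_I beta (single (1%g : Z g) (1 : k^o)))).
  by rewrite Kpt_I1.
by rewrite sector_to_double_single scale1r.
Qed.

(** Products of images of distinct summands vanish, which matches the componentwise product of the
    direct sum. *)
Lemma inertia_to_doubleM : {morph inertia_to_double : u v / u * v}.
Proof.
move=> u v; rewrite [RHS]mulr_suml; apply: eq_bigr => g _.
rewrite ffunE sector_to_doubleM [RHS]mulr_sumr (bigD1 g) //= big1 ?addr0 //.
move=> h; exact: sector_to_doubleM0.
Qed.

(** * The isomorphism onto the commuting subalgebra *)

Definition inertia_to_comm (u : Kinertia_pt beta) :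
  subvs_of (Dbeta_comm beta) :=
  vsproj (Dbeta_comm beta) (inertia_to_double u).

Lemma inertia_to_commE u : vsval (inertia_to_comm u) = inertia_to_double u.
Proof. by rewrite vsprojK ?inertia_to_double_comm. Qed.

Lemma inertia_to_comm_is_linear : linear inertia_to_comm.
Proof. by move=> a u v; rewrite /inertia_to_comm !linearP. Qed.
HB.instance Definition _ :=
  GRing.isLinear.Build k (Kinertia_pt beta) (subvs_of (Dbeta_comm beta)) _
    inertia_to_comm inertia_to_comm_is_linear.

Lemma inertia_to_comm_is_monoid_morphism : monoid_morphism inertia_to_comm.
Proof.
split=> [|u v]; apply: subvs_inj; rewrite /= !inertia_to_commE.
  (* The unit of a subalgebra is its [algid], which equals 1 because 1, being an image, lies in the
     subalgebra. *)
  rewrite inertia_to_double1; apply/esym/eqP; rewrite algid_eq1.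
  by rewrite -inertia_to_double1 inertia_to_double_comm.
by rewrite inertia_to_doubleM.
Qed.
HB.instance Definition _ :=
  GRing.isMonoidMorphism.Build (Kinertia_pt beta) (subvs_of (Dbeta_comm beta))
    inertia_to_comm inertia_to_comm_is_monoid_morphism.

Lemma inertia_to_comm_bij : bijective inertia_to_comm.
Proof.
exists (double_to_inertia \o vsval) => [u | d] /=.
  by rewrite inertia_to_commE inertia_to_doubleK.
by apply: subvs_inj; rewrite inertia_to_commE double_to_inertiaK ?subvsP.
Qed.

End PointAlgebra.

(** * DPR induction of a free family: from k[G] (x) B_g to D^beta (x) B_e *)

Section Induction.
Variables (k : fieldType) (gT : finGroupType) (beta : cocycle3 k gT).
Variable A : free_family beta.
Local Notation Z g := (subg_of 'C[g]).

Lemma ffJ_is_linear g : linear (@ffJ _ _ _ A g).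
Proof.
move=> a u v; apply: (can_inj (@ffIK _ _ _ A g)).
by rewrite linearP !ffJK.
Qed.
HB.instance Definition _ g :=
  GRing.isLinear.Build k (ffB A g) {ffun Z g -> ffE A} _ (@ffJ _ _ _ A g)
    (@ffJ_is_linear g).

Lemma ff_expand g (v : ffB A g) :
  v = \sum_(z : Z g) ffI A g (single z (ffJ v z)).
Proof. by rewrite -linear_sum -sum_single ffJK. Qed.

(** The g-part of [dpr_to_double], taken on k[G] (x) B_g itself so that no representative of a class
    is involved. *)
Definition summand_to_double g (s : {ffun gT -> ffB A g}) : DbetaE A :=
  \sum_r \sum_(z : Z g)
    single ((r * g * r^-1)%g, (r * val z)%g)
      (theta beta (r * g * r^-1)%g r (val z) *: ffJ (s r) z).

Lemma summand_to_double_is_linear g : linear (@summand_to_double g).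
Proof.
move=> a u v; rewrite scaler_sumr -big_split; apply: eq_bigr => r _.
rewrite scaler_sumr -big_split; apply: eq_bigr => z _ /=.
rewrite !ffunE linearP !ffunE scalerDr scalerA mulrC -scalerA.
by rewrite linearP.
Qed.
HB.instance Definition _ g :=
  GRing.isLinear.Build k {ffun gT -> ffB A g} (DbetaE A) _
    (@summand_to_double g) (@summand_to_double_is_linear g).

Lemma summand_to_double_single g r (z : Z g) b :
  summand_to_double (single r (ffI A g (single z b)))
  = single ((r * g * r^-1)%g, (r * val z)%g)
      (theta beta (r * g * r^-1)%g r (val z) *: b).
Proof.
rewrite /summand_to_double (bigD1 r) //= [X in _ + X]big1 => [|x xr];
  last first.
  rewrite big1 // => w _.
  by rewrite ffunE (negbTE xr) linear0 ffunE scaler0 linear0.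
rewrite addr0 (bigD1 z) //= big1 => [|w wz].
  by rewrite addr0 ffunE eqxx ffIK ffunE eqxx.
by rewrite ffunE eqxx ffIK ffunE (negbTE wz) scaler0 linear0.
Qed.

Lemma conj_cent g (x : gT) (z : Z g) :
  (x * val z * g * (x * val z)^-1 = x * g * x^-1)%g.
Proof.
by have /cent1P zg := valP z; rewrite invMg !mulgA -(mulgA x) zg mulgA mulgK.
Qed.

Lemma dpr_rel_is_linear g x (z : Z g) : linear (@dpr_rel _ _ _ A g x z).
Proof.
move=> a u v; rewrite /dpr_rel mulrDr -scalerAr !linearP /= addrACA.
by rewrite !scalerA [a * _]mulrC.
Qed.
HB.instance Definition _ g x (z : Z g) :=
  GRing.isLinear.Build k (ffB A g) {ffun gT -> ffB A g} _
    (@dpr_rel _ _ _ A g x z) (@dpr_rel_is_linear g x z).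

Lemma dpr_relE g x (z w : Z g) (b : ffE A) :
  dpr_rel x z (ffI A g (single w b))
  = theta beta (x * g * x^-1)%g x (val z)
      *: single (x * val z)%g (ffI A g (single w b))
    - theta beta g (val z) (val w) *: single x (ffI A g (single (z * w)%g b)).
Proof. by rewrite /dpr_rel ffIM mul1r linearZ. Qed.

(** Put h = x g x^-1, so that h ^ x = g. On v = w (x) b both terms of the relation land at (h, x z
    w), and their coefficients agree by [thetaP]: theta_h(x, z) theta_h(x z, w) = theta_g(z, w)
    theta_h(x, z w). *)
Lemma summand_to_double_rel g x (z : Z g) (v : ffB A g) :
  summand_to_double (dpr_rel x z v) = 0.
Proof.
rewrite (ff_expand v) !linear_sum big1 // => w _; rewrite /= dpr_relE.
rewrite linearB !linearZ /= !summand_to_double_single conj_cent.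
apply/eqP; rewrite scalerN subr_eq0 /= mulgA -!linearZ /= !scalerA.
have := thetaP beta (x * g * x^-1)%g x (sgval z) (sgval w).
by rewrite conjgE !mulgA mulgKV mulVg mul1g => thE; rewrite mulrC thE mulrC.
Qed.

Lemma summand_to_double_relations g :
  {in dpr_relations A g, @summand_to_double g =1 \0}.
Proof.
move=> _ /memv_sumP[s s_mem ->]; rewrite linear_sum big1 // => x _.
have /memv_sumP[t t_mem ->] := s_mem x isT; rewrite linear_sum big1 // => z _.
apply: (span_eq (f := @summand_to_double g) (g := \0) _ (t_mem z isT)).
move=> _ /mapP[v _ ->].
exact: summand_to_double_rel.
Qed.

(** Since the relations are killed, the map descends to the quotient and does not depend on the
    representative. *)
Lemma summand_to_double_quot g (s : {ffun gT -> ffB A g}) :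
  summand_to_double (vsval (quot_class (dpr_relations A g) s))
  = summand_to_double s.
Proof.
apply/esym/eqP; rewrite -subr_eq0 -linearB.
by rewrite [X in X == _]summand_to_double_relations ?vsval_quot_class.
Qed.

(** The relation space is generated by relations with [v] in a basis of B_g; linearity in [v] gives
    the others. *)
Lemma dpr_rel_mem g x (z : Z g) (v : ffB A g) :
  dpr_rel x z v \in dpr_relations A g.
Proof.
apply: (subvP (sumv_sup x isT (sumv_sup z isT (subvv _)))).
rewrite (coord_vbasis (memvf v)) linear_sum; apply: rpred_sum => i _.
rewrite linearZ; apply: rpredZ; apply: memv_span; apply: map_f.
by rewrite mem_nth ?size_tuple.
Qed.

(** * The inverse map, lifted to k[G] (x) B_g *)

Definition double_to_summand g (w : DbetaE A) : {ffun gT -> ffB A g} :=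
  [ffun r => ffI A g (single 1%g (w ((r * g * r^-1)%g, r)))].

Lemma double_to_summand_is_linear g : linear (double_to_summand g).
Proof. by move=> a u v; apply/ffunP => r; rewrite !ffunE !linearP. Qed.
HB.instance Definition _ g :=
  GRing.isLinear.Build k (DbetaE A) {ffun gT -> ffB A g} _ (double_to_summand g)
    (double_to_summand_is_linear g).

(** For fixed r, conjugation by r is injective, so the index (r h r^-1, r) is met in the h-summand
    only. *)
Lemma double_to_summand_single g h r b :
  double_to_summand g (single ((r * h * r^-1)%g, r) b)
  = if g == h then single r (ffI A g (single 1%g b)) else 0.
Proof.
apply/ffunP => x; rewrite !ffunE xpair_eqE.
have [-> | xr] := eqVneq x r; last first.
  by rewrite andbF !linear0; case: ifP => _; rewrite !ffunE ?(negbTE xr).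
rewrite andbT (inj_eq (mulIg _)) (inj_eq (mulgI _)).
by case: eqP => _; rewrite !ffunE ?eqxx // !linear0.
Qed.

Lemma summand_expand g (s : {ffun gT -> ffB A g}) :
  s = \sum_r \sum_(z : Z g) single r (ffI A g (single z (ffJ (s r) z))).
Proof.
rewrite {1}(sum_single s); apply: eq_bigr => r _.
by rewrite {1}(ff_expand (s r)) linear_sum.
Qed.

Lemma double_to_summand_off g h (s : {ffun gT -> ffB A h}) :
  g != h -> double_to_summand g (summand_to_double s) = 0.
Proof.
move=> gh; rewrite linear_sum big1 // => r _; rewrite linear_sum big1 // => z _.
by rewrite /= -(conj_cent r z) double_to_summand_single (negbTE gh).
Qed.

(** The composite turns r (x) (z (x) b) into theta_(r g r^-1)(r, z) times r z (x) (1 (x) b); the two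
    tensors differ by a relation. *)
Lemma summand_to_doubleK g (s : {ffun gT -> ffB A g}) :
  quot_class (dpr_relations A g) (double_to_summand g (summand_to_double s))
  = quot_class (dpr_relations A g) s.
Proof.
rewrite [in RHS](summand_expand s) !linear_sum; apply: eq_bigr => r _.
rewrite !linear_sum; apply: eq_bigr => z _; apply: quot_class_eq.
(* Writing r g r^-1 as a conjugate by r z gives the index the shape (y g y^-1, y) with y = r z. *)
rewrite /= -(conj_cent r z) double_to_summand_single eqxx.
(* The relation for r, z and 1 (x) b is exactly the difference, because theta_g(z, e) = 1. *)
set b := ffJ _ _; have := dpr_rel_mem r z (ffI A g (single 1%g b)).
by rewrite dpr_relE /= mulg1 theta1r scale1r conj_cent !linearZ.
Qed.

(** * The bijection between the induced module and D^beta (x) B_e *)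

Lemma dpr_to_doubleE (u : Ind_DPR A) :
  dpr_to_double u = \sum_g summand_to_double (vsval (u g)).
Proof. by []. Qed.

Lemma dpr_to_double_is_linear : linear (@dpr_to_double _ _ _ A).
Proof.
move=> a u v; rewrite !dpr_to_doubleE scaler_sumr -big_split.
by apply: eq_bigr => g _; rewrite !ffunE !linearP.
Qed.
HB.instance Definition _ :=
  GRing.isLinear.Build k (Ind_DPR A) (DbetaE A) _ (@dpr_to_double _ _ _ A)
    dpr_to_double_is_linear.

Lemma dpr_to_doubleK : cancel (@dpr_to_double _ _ _ A) (@dpr_of_double _ _ _ A).
Proof.
move=> u; apply/ffunP => g; rewrite ffunE -/(double_to_summand g _).
rewrite dpr_to_doubleE.
rewrite linear_sum (bigD1 g) //= big1 => [|h hg]; last first.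
  by rewrite double_to_summand_off // eq_sym.
by rewrite addr0 summand_to_doubleK quot_class_val.
Qed.

Lemma dpr_of_doubleK : cancel (@dpr_of_double _ _ _ A) (@dpr_to_double _ _ _ A).
Proof.
move=> w; rewrite dpr_to_doubleE.
under eq_bigr => g _ do rewrite ffunE summand_to_double_quot.
under eq_bigr => g _ do rewrite (sum_single (finfun _)) linear_sum.
rewrite exchange_big [RHS]sum_single pair_big_dep /=.
(* The sum over pairs (r, g) becomes a sum over (h, r) with g = r^-1 h r; the inverse substitution
   is h = r g r^-1. *)
rewrite (reindex (fun p => (p.2, (p.2^-1 * p.1 * p.2)%g))) /=; last first.
  exists (fun p => ((p.1 * p.2 * p.1^-1)%g, p.1)) => -[x y] _ /=.
    by congr pair; rewrite !mulgA mulgV mul1g mulgK.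
  by congr pair; rewrite !mulgA mulVg mul1g mulgKV.
apply: eq_bigr => -[h r] _ /=.
rewrite ffunE summand_to_double_single /= mulg1 theta1r scale1r.
by rewrite !mulgA mulgV mul1g mulgK.
Qed.

Lemma dpr_to_double_tensor g r (b : ffE A) :
  dpr_to_double (dpr_tensor r (ffI A g (single 1%g b)))
  = single ((r * g * r^-1)%g, r) b.
Proof.
rewrite dpr_to_doubleE.
rewrite (sum_dirsum_in (F := fun g u => summand_to_double (vsval u)));
  last first.
  by move=> h; rewrite !linear0.
rewrite summand_to_double_quot summand_to_double_single.
by rewrite mulg1 theta1r scale1r.
Qed.

End Induction.

(** * Specialization to the point, where B_e = k *)

Section PointInduction.
Variables (k : fieldType) (gT : finGroupType) (beta : cocycle3 k gT).
Local Notation A := (Kinertia_family beta).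

(** For B_e = k, D^beta (x) B_e and D^beta have the same underlying functions, and tensoring with a
    scalar is scaling. *)
Lemma DbetaE_mulE (u v : Dbeta beta) :
  DbetaE_mul (A := A) u v = u * v :> Dbeta beta.
Proof.
apply: eq_bigr => p _; apply: eq_bigr => q _; apply/ffunP => x.
by rewrite /dbas [_ * _]bilin_single !ffunE /GRing.scale /= mulrC.
Qed.

Lemma DbetaE_oneE : DbetaE_one A = 1 :> Dbeta beta.
Proof. by apply/ffunP => p; rewrite ffunE /GRing.scale /= mulr1. Qed.

Definition ind_to_double (u : Ind_DPR A) : Dbeta beta := dpr_to_double u.

Lemma ind_to_double_is_linear : linear ind_to_double.
Proof. exact: dpr_to_double_is_linear. Qed.
HB.instance Definition _ :=
  GRing.isLinear.Build k (Ind_DPR A) (Dbeta beta) _ ind_to_double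
    ind_to_double_is_linear.

Lemma ind_to_double_bij : bijective ind_to_double.
Proof.
exact: Bijective (@dpr_to_doubleK _ _ _ A) (@dpr_of_doubleK _ _ _ A).
Qed.

Lemma ind_to_double1 : ind_to_double (dpr_one A) = 1.
Proof. by rewrite /ind_to_double dpr_of_doubleK DbetaE_oneE. Qed.

(** The product on the induced module is transported from D^beta (x) B_e, so cancellation leaves
    only the comparison of the products on the two forms of D^beta. *)
Lemma ind_to_doubleM u v :
  ind_to_double (dpr_mul u v) = ind_to_double u * ind_to_double v.
Proof. by rewrite /ind_to_double dpr_of_doubleK DbetaE_mulE. Qed.

Lemma ind_to_double_tensor g r (b : ffE A) :
  ind_to_double (dpr_tensor (A := A) r (ffI A g (single 1%g b)))
  = (b : k) *: dbas beta (r * g * r^-1)%g r.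
Proof.
rewrite /ind_to_double dpr_to_double_tensor; apply/ffunP => p; rewrite !ffunE.
by case: eqP => _; rewrite /GRing.scale /= (mulr1, mulr0).
Qed.

End PointInduction.

Theorem theorem4p14 (k : fieldType) (gT : finGroupType)
    (char0 : [pchar k] =i pred0) (beta : cocycle3 k gT) :
  (exists f : {lrmorphism Kinertia_pt beta -> subvs_of (Dbeta_comm beta)},
     bijective f /\
     forall (g : gT) (m : subg_of 'C[g]),
       vsval (f (Kpt_basis beta m)) = dbas beta g (val m)) /\
  (exists f : {linear Ind_DPR (Kinertia_family beta) -> Dbeta beta},
     [/\ bijective f,
         f (dpr_one (Kinertia_family beta)) = 1,
         forall u v, f (dpr_mul u v) = f u * f v
       & forall (g r : gT) (b : ffE (Kinertia_family beta)),
           f (dpr_tensor (A := Kinertia_family beta) r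
                (ffI (Kinertia_family beta) g (single 1%g b)))
           = (b : k) *: dbas beta (r * g * r^-1)%g r]).
Proof.
split; first exists (inertia_to_comm (beta := beta)).
  split=> [|g m]; first exact: inertia_to_comm_bij.
  by rewrite /= inertia_to_commE inertia_to_double_basis.
exists (ind_to_double (beta := beta)).
split; [exact: ind_to_double_bij | exact: ind_to_double1 | |].
  exact: ind_to_doubleM.
exact: ind_to_double_tensor.
Qed.
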